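(* Let $H:(\mathbb{P}\times\mathbb{R}^m)^{+}\to\mathbb{R}^{n_y}$ be a response map which has an impulse response representation (IRR), and let $\Psi_H$ be the associated family of maps. Then: (A) If $\Psi_H$ has a finite Hankel-rank, then $H$ is IRR-UD if and only if $H$ is IRR-UED (with some rate $\beta\in(0,1)$). (B) $H$ has a realization by a globally uniformly exponentially stable (GUES) LPV-SSA (LSS, in the case $\mathbb{P}=\{e_1,\ldots,e_{n_p}\}$) if and only if $\Psi_H$ has a finite Hankel-rank and $H$ is IRR-UD. (C) For $\beta\in(0,1)$, $H$ is IRR-UED with rate $\beta$ if and only if all minimal LPV-SSA (LSS, in the case $\mathbb{P}=\{e_1,\ldots,e_{n_p}\}$) realizations of $H$ are GUES with rate $\beta$.
   Context: Notation: $X^{*}$, $X^{+}$, $X^{k}$, $X^{\infty}$ denote the finite words (including the empty word), nonempty finite words, words of length $k$, and infinite sequences over $X$; $w[k]$ is the $k$-th element and $|w|$ the length of $w$; $\|\cdot\|_2$ is the Euclidean/spectral norm. $\mathbb{P}\subseteq\mathbb{R}^{n_p}$ is contained in the standard simplex $\{x\in[0,1]^{n_p}\mid\sum_i x_i=1\}$ and contains the standard unit vectors $e_1,\ldots,e_{n_p}$. $Q=\{1,\ldots,n_p\}$. LPV-SSA: a system $x(t+1)=A(p(t))x(t)+B(p(t))v(t)$, $x(0)=0$, $y(t)=C(p(t))x(t)$, with scheduling $p(t)\in\mathbb{P}$, control input $v(t)\in\mathbb{R}^m$, output $y(t)\in\mathbb{R}^{n_y}$, $x(t)\in\mathbb{R}^n$,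 and $A(p)=\sum_{i=1}^{n_p}A_ip_i$, $B(p)=\sum_{i=1}^{n_p}B_ip_i$, $C(p)=\sum_{i=1}^{n_p}C_ip_i$ for real matrices $A_i,B_i,C_i$. Its dimension is $n$. When $\mathbb{P}=\{e_1,\ldots,e_{n_p}\}$ it is called a linear switched system (LSS). It is a realization of $H$ if for all $t\ge1$ and $w=(p[1],v[1])\cdots(p[t],v[t])$ one has $H(w)=C(p[t])x_t$, where $x_1=0$ and $x_{s+1}=A(p[s])x_s+B(p[s])v[s]$. It is minimal if its dimension is minimal among all LPV-SSA (respectively LSS) realizations of $H$. It is GUES with rate $\beta\in(0,1)$ if there is $C\ge1$ such that $\|A(\underline{p}[k])\cdots A(\underline{p}[1])\|_2<C\beta^k$ for all $k>0$, $\underline{p}\in\mathbb{P}^k$; it is GUES if this holds for some $\beta\in(0,1)$. IRR: $H$ has an impulse response representation if there is $S:\bigcup_{k=2}^{\infty}Q^k\to\mathbb{R}^{n_y\times m}$ such that for all $\underline{p}\in\mathbb{P}^\infty$, $\underline{v}\in(\mathbb{R}^m)^\infty$, $t\ge1$, $$H((\underline{p}[1],\underline{v}[1])\cdots(\underline{p}[t],\underline{v}[t]))=\sum_{\tau=1}^{t-1}(h\diamond\underline{p})(t,\tau)\,\underline{v}[\tau],\qquad (h\diamond\underline{p})(t,\tau)=\sum_{s\in Q^{t-\tau+1}}S(s)\,\underline{p}_s(t)\quad(1\le\tau\le t-1),$$ where $\underline{p}_s(t)=\prod_{i=1}^{|s|}(\underline{p}[t-|s|+i])_{s[i]}$ and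 $(\underline{p}[k])_r$ is the $r$-th component of $\underline{p}[k]$. $\Psi_H$: for $q\in Q$, $l\in\{1,\ldots,m\}$, let $M_{q,l}:Q^{*}\to\mathbb{R}^{n_pn_y}$, $M_{q,l}(w)=\big[(S_{\cdot,l}(qw1))^T,\ldots,(S_{\cdot,l}(qwn_p))^T\big]^T$, where $S_{\cdot,l}(s)$ is the $l$-th column of $S(s)$. Then $\Psi_H=\{M_{q,l}\}_{(q,l)\in Q\times\{1,\ldots,m\}}$. Its Hankel-rank is the dimension of the span (pointwise operations) of the maps $w\mapsto M_{q,l}(vw)$ on $Q^{*}$, over all $v\in Q^{*}$, $q\in Q$, $1\le l\le m$. IRR-UD: $\lim_{N\to\infty}\sup_{\underline{p}\in\mathbb{P}^\infty,\,\tau\in\mathbb{N},\,\tau\ge1}\|(h\diamond\underline{p})(N+\tau,\tau)\|_2=0$. IRR-UED with rate $\beta\in(0,1)$: there is $C>0$ such that for all $N\ge1$, $\sup_{\underline{p}\in\mathbb{P}^\infty,\,\tau\in\mathbb{N},\,\tau\ge1}\|(h\diamond\underline{p})(N+\tau,\tau)\|_2<C\beta^{N-1}$.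
   Formalization: In (C) it is additionally assumed that H has some LPV-SSA (LSS) realization; without one, ''all minimal realizations are GUES'' is vacuously true while IRR-UED can fail, e.g. for n_p = m = n_y = 1 and S(1^k) = k!. *)

(* Defs.v *)
From mathcomp Require Import all_boot all_order all_algebra.
From mathcomp Require Import all_classical all_reals all_analysis.

Set Implicit Arguments.
Unset Strict Implicit.
Unset Printing Implicit Defensive.

Import Order.TTheory GRing.Theory Num.Theory.
Import numFieldNormedType.Exports.
Local Open Scope classical_set_scope.
Local Open Scope ring_scope.

(* Conventions.  Q = {1, ..., np} is ['I_np].  An infinite sequence over X is
   a function [p : nat -> X] indexed from 1 ([p 0] is never used as a letter of
   a word).  A map on the nonempty words over P x R^m is a function on all
   words over R^np x R^m; only its values at nonempty words whose scheduling
   letters lie in P are ever used.  Likewise an impulse response S is a function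
   on all words over Q; only its values at words of length >= 2 matter. *)

Section Norms.
Context {R : realType}.

(* The library norm of a matrix is the max norm, hence these definitions. *)
Definition norm2 {n : nat} (x : 'cV[R]_n) : R :=
  Num.sqrt (\sum_(i < n) x i ord0 ^+ 2).

Definition spectral_norm {k n : nat} (A : 'M[R]_(k, n)) : R :=
  sup [set norm2 (A *m x) | x in [set x : 'cV[R]_n | norm2 x <= 1]].

End Norms.

Section Dimension.
Context {R : realType} {V : lmodType R}.

(* [vector.span] lives in finite-dimensional spaces; the Hankel-rank concerns
   a subspace of the space of all maps on Q^*. *)
Definition lin_span (X : set V) : set V :=
  [set y | exists (n : nat) (c : 'I_n -> R) (x : 'I_n -> V),
    (forall i, X (x i)) /\ y = \sum_(i < n) c i *: x i].

Definition lin_indep {d : nat} (b : 'I_d -> V) : Prop :=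
  forall c : 'I_d -> R, \sum_(i < d) c i *: b i = 0 -> forall i, c i = 0.

Definition has_dim (E : set V) (d : nat) : Prop :=
  exists b : 'I_d -> V, lin_indep b /\ lin_span (range b) = E.

End Dimension.

Section Systems.
Context {R : realType} {np m ny : nat}.

Definition std_simplex : set 'cV[R]_np :=
  [set x | (forall i, 0 <= x i ord0 <= 1) /\ \sum_(i < np) x i ord0 = 1].

Definition unit_vector (i : 'I_np) : 'cV[R]_np := delta_mx i ord0.

Implicit Types (P : set 'cV[R]_np).

(* An LPV-SSA of dimension n, given by its matrices; the scheduling set P is a
   parameter of the notions below.  An LSS is an LPV-SSA with
   P = {e_1, ..., e_np}, so every notion below specializes to LSSs by taking
   P to be that set. *)
Record lpv_ssa (n : nat) := LPVSSA {
  matA : 'I_np -> 'M[R]_(n, n);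
  matB : 'I_np -> 'M[R]_(n, m);
  matC : 'I_np -> 'M[R]_(ny, n) }.

Definition lpv_mat {k l : nat} (M : 'I_np -> 'M[R]_(k, l)) (p : 'cV[R]_np) :
    'M[R]_(k, l) :=
  \sum_(i < np) p i ord0 *: M i.

Definition lpv_step {n : nat} (sys : lpv_ssa n) (x : 'cV[R]_n)
    (pv : 'cV[R]_np * 'cV[R]_m) : 'cV[R]_n :=
  lpv_mat (matA sys) pv.1 *m x + lpv_mat (matB sys) pv.1 *m pv.2.

Definition lpv_state {n : nat} (sys : lpv_ssa n)
    (w : seq ('cV[R]_np * 'cV[R]_m)) : 'cV[R]_n :=
  foldl (lpv_step sys) 0 w.

(* The last input value does not affect the output: in the word
   w (p, v) the output is C(p) x_t, where x_t is reached along w. *)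
Definition is_realization P
    (H : seq ('cV[R]_np * 'cV[R]_m) -> 'cV[R]_ny)
    {n : nat} (sys : lpv_ssa n) : Prop :=
  forall (w : seq ('cV[R]_np * 'cV[R]_m)) (pv : 'cV[R]_np * 'cV[R]_m),
    (forall qu, qu \in rcons w pv -> P qu.1) ->
    H (rcons w pv) = lpv_mat (matC sys) pv.1 *m lpv_state sys w.

Definition is_minimal_realization P
    (H : seq ('cV[R]_np * 'cV[R]_m) -> 'cV[R]_ny)
    {n : nat} (sys : lpv_ssa n) : Prop :=
  is_realization P H sys /\
  forall (n' : nat) (sys' : lpv_ssa n'), is_realization P H sys' -> (n <= n')%N.

(* A(p[k]) ... A(p[1]) for the word p of length k: later letters multiply on
   the left. *)
Definition lpv_transition {n : nat} (sys : lpv_ssa n) (p : seq 'cV[R]_np) :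
    'M[R]_(n, n) :=
  foldl (fun F q => lpv_mat (matA sys) q *m F) 1%:M p.

Definition GUES_rate P {n : nat} (sys : lpv_ssa n) (beta : R) : Prop :=
  exists2 C : R, 1 <= C &
    forall p : seq 'cV[R]_np, (0 < size p)%N -> (forall q, q \in p -> P q) ->
      spectral_norm (lpv_transition sys p) < C * beta ^+ size p.

Definition GUES P {n : nat} (sys : lpv_ssa n) : Prop :=
  exists2 beta : R, 0 < beta < 1 & GUES_rate P sys beta.

(* [tnth s i] is the letter s[i+1], which is why the index into p is i.+1. *)
Definition sched_mono (p : nat -> 'cV[R]_np) {k : nat} (s : k.-tuple 'I_np)
    (t : nat) : R :=
  \prod_(i < k) p (t - k + i.+1)%N (tnth s i) ord0.

(* (h <> p)(t, tau), meaningful for 1 <= tau <= t - 1. *)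
Definition impulse (S : seq 'I_np -> 'M[R]_(ny, m)) (p : nat -> 'cV[R]_np)
    (t tau : nat) : 'M[R]_(ny, m) :=
  \sum_(s : (t - tau).+1.-tuple 'I_np) sched_mono p s t *: S s.

Definition prefix_word (p : nat -> 'cV[R]_np) (v : nat -> 'cV[R]_m) (t : nat) :
    seq ('cV[R]_np * 'cV[R]_m) :=
  [seq (p k, v k) | k <- iota 1 t].

(* S is unique at words of length >= 2 when P contains the unit vectors, so the
   notions below depending on S are in fact properties of H. *)
Definition is_IRR P (H : seq ('cV[R]_np * 'cV[R]_m) -> 'cV[R]_ny)
    (S : seq 'I_np -> 'M[R]_(ny, m)) : Prop :=
  forall (p : nat -> 'cV[R]_np) (v : nat -> 'cV[R]_m) (t : nat),
    (forall k, P (p k)) -> (1 <= t)%N ->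
    H (prefix_word p v t) = \sum_(1 <= tau < t) impulse S p t tau *m v tau.

Definition Mmap (S : seq 'I_np -> 'M[R]_(ny, m)) (q : 'I_np) (l : 'I_m)
    (w : seq 'I_np) : 'cV[R]_(\sum_(j < np) ny) :=
  \mxcol_(j < np) col l (S (q :: rcons w j)).

Definition hankel_maps (S : seq 'I_np -> 'M[R]_(ny, m)) :
    set (seq 'I_np -> 'cV[R]_(\sum_(j < np) ny)) :=
  [set f | exists (v : seq 'I_np) (q : 'I_np) (l : 'I_m),
    f = fun w => Mmap S q l (v ++ w)].

Definition hankel_rank (S : seq 'I_np -> 'M[R]_(ny, m)) (d : nat) : Prop :=
  has_dim (lin_span (hankel_maps S)) d.

Definition finite_hankel_rank (S : seq 'I_np -> 'M[R]_(ny, m)) : Prop :=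
  exists d : nat, hankel_rank S d.

Definition impulse_sup P (S : seq 'I_np -> 'M[R]_(ny, m)) (N : nat) : \bar R :=
  ereal_sup [set e | exists (p : nat -> 'cV[R]_np) (tau : nat),
    [/\ forall k, P (p k), (1 <= tau)%N &
        e = (spectral_norm (impulse S p (N + tau) tau))%:E]].

Definition IRR_UD P (S : seq 'I_np -> 'M[R]_(ny, m)) : Prop :=
  impulse_sup P S N @[N --> \oo] --> 0%E.

Definition IRR_UED P (S : seq 'I_np -> 'M[R]_(ny, m)) (beta : R) : Prop :=
  exists2 C : R, 0 < C &
    forall N : nat, (1 <= N)%N ->
      (impulse_sup P S N < (C * beta ^+ (N - 1))%:E)%E.

End Systems.

Arguments lpv_ssa R np m ny n : clear implicits.
Arguments std_simplex R np : clear implicits.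

(* Main.v *)
Require Import Defs.
From mathcomp Require Import all_boot all_order all_algebra.
From mathcomp Require Import all_classical all_reals all_analysis.
From mathcomp Require Import zify lra.

Import Order.TTheory GRing.Theory Num.Theory.
Import numFieldNormedType.Exports.
Local Open Scope classical_set_scope.
Local Open Scope ring_scope.

Set Implicit Arguments.
Unset Strict Implicit.
Unset Printing Implicit Defensive.

(** The impulse response is the multilinear extension, from words over $Q$ to
    words over the simplex, of the function $S$ (impulseE, mlext). Hence a system
    realizes $H$ if and only if $S(q w j) = C_j A_w B_q$ for all words $q w j$,
    where $A_w$ is the product of the matrices of the letters of $w$, and then
    the impulse response along $p\, ps\, p'$ is $C(p') \Phi(ps) B(p)$, with
    $\Phi(ps)$ the transition matrix (mlext_realizes,
    realization_realizes_impulse, realizes_impulse_realization). In particular a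
    decay of $\Phi$ is inherited by the impulse response
    (GUES_rate_IRR_UED).

    The converse needs reachability and observability. The Hankel maps are the
    observations of reachable states, so their span has dimension at most $n$;
    conversely, shifts of Hankel maps give a realization on that span
    (realization_hankel_basis, hankel_rank_realization). For a minimal system
    the dimensions agree, which forces the reachable states to span the state
    space and the observation map to be injective: there are finitely many
    words with $1 = \sum_i A_{v_i} B_{q_i} E_i$ and
    $1 = \sum_i F_i C_{j_i} A_{w_i}$ (minimal_reachable_observable). Multiplying
    $\Phi(ps)$ by these identities on both sides writes it as
    $\sum F_{i'} h(q_i v_i\, ps\, w_{i'} j_{i'}) E_i$, with $h$ the impulse
    response; the inserted words are finitely many, so any uniform decay of $h$
    is inherited by $\Phi$ with the same rate (transition_bound,
    IRR_UED_GUES_rate).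

    If the decay of $h$ comes without a rate, then all transition matrices of
    some fixed length have norm at most $1/2$, and submultiplicativity yields an
    exponential rate (GUES_of_contraction). So for finite Hankel rank
    uniform decay gives a stable realization, which in turn gives uniform
    exponential decay. *)

(** * The entrywise norm *)

Section EntrywiseNorm.
Context {R : realType}.

(** Equivalent to the spectral norm, and submultiplicative by an elementary
    computation. *)
Definition norm1 {k n : nat} (A : 'M[R]_(k, n)) : R := \sum_i \sum_j `|A i j|.

Lemma norm1_ge0 k n (A : 'M[R]_(k, n)) : 0 <= norm1 A.
Proof. by apply: sumr_ge0 => i _; apply: sumr_ge0. Qed.

Lemma norm1D k n (A B : 'M[R]_(k, n)) : norm1 (A + B) <= norm1 A + norm1 B.
Proof.
rewrite /norm1 -big_split /=; apply: ler_sum => i _.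
by rewrite -big_split /=; apply: ler_sum => j _; rewrite mxE ler_normD.
Qed.

Lemma norm1_0 k n : norm1 (0 : 'M[R]_(k, n)) = 0.
Proof. by rewrite /norm1 big1 // => i _; rewrite big1 // => j _; rewrite mxE normr0. Qed.

Lemma norm1_sum k n (I : Type) (r : seq I) (P : pred I) (A : I -> 'M[R]_(k, n)) :
  norm1 (\sum_(i <- r | P i) A i) <= \sum_(i <- r | P i) norm1 (A i).
Proof.
elim/big_ind2: _ => [|x a y b xa yb|//]; first by rewrite norm1_0.
by apply: le_trans (norm1D _ _) _; apply: lerD.
Qed.

Lemma norm1Z k n (a : R) (A : 'M[R]_(k, n)) : norm1 (a *: A) = `|a| * norm1 A.
Proof.
rewrite /norm1 mulr_sumr; apply: eq_bigr => i _.
by rewrite mulr_sumr; apply: eq_bigr => j _; rewrite mxE normrM.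
Qed.

Lemma norm1M k l n (A : 'M[R]_(k, l)) (B : 'M[R]_(l, n)) :
  norm1 (A *m B) <= norm1 A * norm1 B.
Proof.
rewrite /norm1 mulr_suml; apply: ler_sum => i _.
apply: (@le_trans _ _ (\sum_(t < l) `|A i t| * \sum_j `|B t j|)).
  under [leRHS]eq_bigr do rewrite mulr_sumr.
  rewrite exchange_big /=; apply: ler_sum => j _; rewrite mxE.
  apply: le_trans (ler_norm_sum _ _ _) _.
  by apply: ler_sum => t _; rewrite normrM.
rewrite mulr_suml; apply: ler_sum => t _; apply: ler_wpM2l => //.
rewrite (bigD1 t) //= lerDl; apply: sumr_ge0 => s _; exact: sumr_ge0.
Qed.

Lemma norm1_1 n : norm1 (1%:M : 'M[R]_n) = n%:R.
Proof.
rewrite /norm1 (eq_bigr (fun=> 1)) => [|i _].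
  by rewrite sumr_const card_ord.
rewrite (bigD1 i) //= big1 => [|j ji]; first by rewrite mxE eqxx normr1 addr0.
by rewrite mxE eq_sym (negbTE ji) normr0.
Qed.

Lemma norm2_coord n (x : 'cV[R]_n) i : `|x i ord0| <= norm2 x.
Proof.
rewrite -sqrtr_sqr; apply: ler_wsqrtr.
by rewrite (bigD1 i) //= lerDl; apply: sumr_ge0 => j _; apply: sqr_ge0.
Qed.

Lemma norm2_le_norm1 n (x : 'cV[R]_n) : norm2 x <= norm1 x.
Proof.
have -> : norm1 x = \sum_i `|x i ord0|.
  by apply: eq_bigr => i _; rewrite big_ord1.
have s0 : 0 <= \sum_i `|x i ord0| by apply: sumr_ge0.
rewrite -(ger0_norm s0) -sqrtr_sqr; apply: ler_wsqrtr.
rewrite expr2 mulr_suml; apply: ler_sum => i _.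
by rewrite -real_normK ?num_real // expr2; apply: ler_wpM2l => //;
  rewrite (bigD1 i) //= lerDl; apply: sumr_ge0.
Qed.

Lemma norm2_delta n (j : 'I_n) : norm2 (delta_mx j ord0 : 'cV[R]_n) = 1.
Proof.
rewrite /norm2 (bigD1 j) //= big1 => [|i ij].
  by rewrite mxE !eqxx expr1n addr0 sqrtr1.
by rewrite mxE (negbTE ij) expr0n.
Qed.

Let unit_ball_image k n (A : 'M[R]_(k, n)) : set R :=
  [set norm2 (A *m x) | x in [set x : 'cV[R]_n | norm2 x <= 1]].

Let unit_ball_image_ub k n (A : 'M[R]_(k, n)) : ubound (unit_ball_image A) (norm1 A).
Proof.
move=> _ [x /= x1 <-]; apply: le_trans (norm2_le_norm1 _) _.
rewrite /norm1; apply: ler_sum => i _; rewrite big_ord1 mxE.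
apply: le_trans (ler_norm_sum _ _ _) _; apply: ler_sum => j _.
by rewrite normrM ler_piMr // (le_trans (norm2_coord _ _)).
Qed.

Let unit_ball_image_ge k n (A : 'M[R]_(k, n)) y :
  unit_ball_image A y -> y <= spectral_norm A.
Proof. by apply: ub_le_sup; exists (norm1 A); apply: unit_ball_image_ub. Qed.

Let unit_ball_image0 k n (A : 'M[R]_(k, n)) : unit_ball_image A 0.
Proof.
have z l : norm2 (0 : 'cV[R]_l) = 0.
  rewrite /norm2 big1 ?sqrtr0 // => i _; by rewrite mxE expr0n.
by exists 0; rewrite /= ?mulmx0 ?z.
Qed.

Lemma spectral_norm_ge0 k n (A : 'M[R]_(k, n)) : 0 <= spectral_norm A.
Proof. exact: unit_ball_image_ge. Qed.

Lemma spectral_norm_le_norm1 k n (A : 'M[R]_(k, n)) : spectral_norm A <= norm1 A.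
Proof.
by apply: ge_sup; [exists 0; apply: unit_ball_image0|apply: unit_ball_image_ub].
Qed.

(** Testing the spectral norm on the unit vectors bounds every entry. *)
Lemma norm1_le_spectral_norm k n (A : 'M[R]_(k, n)) :
  norm1 A <= (k * n)%:R * spectral_norm A.
Proof.
have entry i j : `|A i j| <= spectral_norm A.
  have -> : A i j = (A *m delta_mx j ord0 : 'cV_k) i ord0.
    by rewrite -colE mxE.
  apply: le_trans (norm2_coord _ _) _; apply: unit_ball_image_ge.
  by exists (delta_mx j ord0) => //=; rewrite norm2_delta.
rewrite natrM -mulrA mulr_natl -[X in _ *+ X](card_ord k) -sumr_const.
apply: ler_sum => i _; rewrite mulr_natl -[X in _ *+ X](card_ord n) -sumr_const.
exact: ler_sum.
Qed.

End EntrywiseNorm.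

(** * Multilinear extension of a function on words *)

Section MultilinearExtension.
Context {R : realType} {np : nat}.
Implicit Types (ps : seq 'cV[R]_np) (s : seq 'I_np).

(** Reading the letter $p$ means averaging over the letters of $Q$ with weights
    $p_1, ..., p_{n_p}$. *)
Fixpoint mlext {V : lmodType R} (f : seq 'I_np -> V) ps : V :=
  if ps is p :: ps' then \sum_i p i ord0 *: mlext (fun s => f (i :: s)) ps'
  else f [::].

Lemma eq_mlext (V : lmodType R) (f g : seq 'I_np -> V) ps :
  (forall s, f s = g s) -> mlext f ps = mlext g ps.
Proof.
elim: ps f g => [|p ps IH] f g fg /=; first exact: fg.
by apply: eq_bigr => i _; congr (_ *: _); apply: IH.
Qed.

Lemma sum_unit_vector (V : lmodType R) (i : 'I_np) (F : 'I_np -> V) :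
  \sum_j (unit_vector i : 'cV[R]_np) j ord0 *: F j = F i.
Proof.
rewrite (bigD1 i) //= big1 => [|j ji]; first by rewrite mxE !eqxx scale1r addr0.
by rewrite mxE (negbTE ji) scale0r.
Qed.

Lemma mlext_unit (V : lmodType R) (f : seq 'I_np -> V) s :
  mlext f (map unit_vector s) = f s.
Proof. by elim: s f => [//|i s IH] f /=; rewrite sum_unit_vector IH. Qed.

Lemma sum_tuple_cons (V : nmodType) k (F : k.+1.-tuple 'I_np -> V) :
  \sum_s F s = \sum_i \sum_(s : k.-tuple _) F [tuple of i :: s].
Proof.
rewrite pair_bigA /=.
rewrite (reindex (fun u : 'I_np * k.-tuple 'I_np => [tuple of u.1 :: u.2])) //=.
exists (fun s : k.+1.-tuple 'I_np => (thead s, [tuple of behead s])) => [[i s] _|s _] /=.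
  by congr pair; apply: val_inj.
by rewrite -tuple_eta.
Qed.

Lemma sum_prod_mlext (V : lmodType R) (f : seq 'I_np -> V) (p : nat -> 'cV[R]_np) k a :
  \sum_(s : k.-tuple 'I_np) (\prod_(i < k) p (a + i)%N (tnth s i) ord0) *: f s
  = mlext f [seq p j | j <- iota a k].
Proof.
elim: k a f => [|k IH] a f.
  rewrite (big_pred1 [tuple]) => [|s]; first by rewrite big_ord0 scale1r.
  by rewrite [s]tuple0 /= eqxx.
rewrite sum_tuple_cons /=; apply: eq_bigr => i _.
rewrite -IH scaler_sumr; apply: eq_bigr => s _.
rewrite big_ord_recl addn0 tnth0 -scalerA; congr (_ *: (_ *: _)).
by apply: eq_bigr => j _; rewrite tnthS /= /bump /= add1n addnS.
Qed.

Lemma impulseE m ny (S : seq 'I_np -> 'M[R]_(ny, m)) p t tau :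
  (0 < tau <= t)%N ->
  impulse S p t tau = mlext S [seq p j | j <- iota tau (t - tau).+1].
Proof.
move=> /andP[tau0 taut]; rewrite -sum_prod_mlext /impulse /sched_mono.
apply: eq_bigr => s _; congr (_ *: _); apply: eq_bigr => i _.
by congr (p _ _ _); lia.
Qed.

Lemma map_iota_nth (T : Type) (d : T) (r : seq T) :
  [seq nth d r k.-1 | k <- iota 1 (size r)] = r.
Proof.
rewrite -[RHS](mkseq_nth d) /mkseq (iotaDl 1 0) -map_comp.
exact: eq_map.
Qed.

Lemma impulse_sup_le (P : set 'cV[R]_np) m ny (S : seq 'I_np -> 'M[R]_(ny, m)) N (b : R) :
  (impulse_sup P S N <= b%:E)%E <->
  forall ps, size ps = N.+1 -> (forall q, q \in ps -> P q) ->
    spectral_norm (mlext S ps) <= b.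
Proof.
split=> [Hb [//|p0 ps] szp Pps|Hb].
  set p := fun k => nth p0 (p0 :: ps) k.-1.
  rewrite -lee_fin; apply: le_trans Hb; apply: ereal_sup_ubound.
  exists p, 1%N; split=> // [k|].
    rewrite /p; case: (ltnP k.-1 (size (p0 :: ps))) => hk.
      by apply: Pps; apply: mem_nth.
    by rewrite nth_default //; apply: Pps; rewrite mem_head.
  rewrite impulseE; last by lia.
  by rewrite addnK -szp map_iota_nth.
apply: ge_ereal_sup => _ [p [tau [Pp tau0 ->]]]; rewrite lee_fin.
rewrite impulseE; last by lia.
apply: Hb; first by rewrite size_map size_iota; lia.
by move=> q /mapP[k _ ->].
Qed.

End MultilinearExtension.

(** * Realizations and impulse responses *)

Section Realizations.
Context {R : realType} {np m ny : nat}.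
Implicit Types (ps : seq 'cV[R]_np) (w : seq 'I_np) (S : seq 'I_np -> 'M[R]_(ny, m)).

Lemma lpv_mat_unit k l (M : 'I_np -> 'M[R]_(k, l)) i : lpv_mat M (unit_vector i) = M i.
Proof. exact: sum_unit_vector. Qed.

Lemma prefix_word_rcons (p : nat -> 'cV[R]_np) (v : nat -> 'cV[R]_m) t :
  prefix_word p v t.+1 = rcons (prefix_word p v t) (p t.+1, v t.+1).
Proof. by rewrite /prefix_word -[in iota 1 t.+1](addn1 t) iotaD map_cat /= cats1. Qed.

(** The matrices $C_j A_w B_q$ are the values of the impulse response of the
    system along words of unit vectors. *)
Definition realizes_impulse S {n : nat} (sys : lpv_ssa R np m ny n) : Prop :=
  forall q w j, S (q :: rcons w j) =
    matC sys j *m lpv_transition sys (map unit_vector w) *m matB sys q.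

Section OneSystem.
Context {n : nat} (sys : lpv_ssa R np m ny n).

Lemma lpv_transition_cat ps qs :
  lpv_transition sys (ps ++ qs) = lpv_transition sys qs *m lpv_transition sys ps.
Proof.
rewrite /lpv_transition foldl_cat; move: (foldl _ _ ps) => X.
elim/last_ind: qs => [|qs q IH] /=; first by rewrite mul1mx.
by rewrite !foldl_rcons IH mulmxA.
Qed.

Lemma lpv_transition1 p : lpv_transition sys [:: p] = lpv_mat (matA sys) p.
Proof. by rewrite /lpv_transition /= mulmx1. Qed.

Lemma lpv_transition_cons p ps :
  lpv_transition sys (p :: ps) = lpv_transition sys ps *m lpv_mat (matA sys) p.
Proof. by rewrite -cat1s lpv_transition_cat lpv_transition1. Qed.

Lemma lpv_transition_rcons ps p :
  lpv_transition sys (rcons ps p) = lpv_mat (matA sys) p *m lpv_transition sys ps.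
Proof. by rewrite -cats1 lpv_transition_cat lpv_transition1. Qed.

(** Stated for an arbitrary start matrix $X$, because reading the first letter
    $i$ replaces $X$ by $A_i X$. *)
Lemma mlext_rcons l (X : 'M[R]_(n, l)) (f : seq 'I_np -> 'M[R]_(ny, l)) ps p :
  (forall w j, f (rcons w j) =
     matC sys j *m lpv_transition sys (map unit_vector w) *m X) ->
  mlext f (rcons ps p) = lpv_mat (matC sys) p *m lpv_transition sys ps *m X.
Proof.
elim: ps f X => [|p0 ps IH] f X fX /=.
  rewrite mulmx1 /lpv_mat mulmx_suml; apply: eq_bigr => i _.
  by rewrite (fX [::]) /= mulmx1 scalemxAl.
rewrite lpv_transition_cons -!mulmxA [X in _ *m (_ *m X)]mulmx_suml !mulmx_sumr.
apply: eq_bigr => i _; rewrite (IH _ (matA sys i *m X)).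
  by rewrite -scalemxAl -!scalemxAr !mulmxA.
by move=> w j; rewrite (fX (i :: w)) /= lpv_transition_cons lpv_mat_unit !mulmxA.
Qed.

(** Both sides are multilinear in the letters, so agreement on words of unit
    vectors suffices. *)
Lemma mlext_realizes S p ps p' : realizes_impulse S sys ->
  mlext S (p :: rcons ps p') =
  lpv_mat (matC sys) p' *m lpv_transition sys ps *m lpv_mat (matB sys) p.
Proof.
move=> Ssys /=; rewrite mulmx_sumr; apply: eq_bigr => i _.
by rewrite (@mlext_rcons _ (matB sys i)) // -scalemxAr.
Qed.

Lemma lpv_state_prefix p v t :
  lpv_state sys (prefix_word p v t) =
  \sum_(1 <= tau < t.+1)
    lpv_transition sys [seq p k | k <- iota tau.+1 (t - tau)] *m
      lpv_mat (matB sys) (p tau) *m v tau.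
Proof.
elim: t => [|t IH]; first by rewrite big_geq.
rewrite prefix_word_rcons /lpv_state foldl_rcons -/(lpv_state sys _) IH.
rewrite [RHS]big_nat_recr //= subnn /= mul1mx /lpv_step /=; congr (_ + _).
rewrite mulmx_sumr; apply: eq_big_nat => tau /andP[tau1 taut].
rewrite subSn // -[in RHS](addn1 (t - tau)) iotaD map_cat /= cats1 lpv_transition_rcons.
by rewrite !mulmxA addSn subnKC.
Qed.

Lemma output_prefix S p v t : realizes_impulse S sys ->
  lpv_mat (matC sys) (p t.+1) *m lpv_state sys (prefix_word p v t) =
  \sum_(1 <= tau < t.+1) impulse S p t.+1 tau *m v tau.
Proof.
move=> Ssys; rewrite lpv_state_prefix mulmx_sumr.
apply: eq_big_nat => tau /andP[tau1 taut]; rewrite !mulmxA impulseE; last by lia.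
congr (_ *m _); rewrite subSn // -(@mlext_realizes S) //; congr (mlext S _).
rewrite -(addn1 (t - tau).+1) iotaD map_cat /= cats1 /=.
by rewrite addnS subnKC.
Qed.

End OneSystem.

Section ResponseMap.
Context (P : set 'cV[R]_np) (H : seq ('cV[R]_np * 'cV[R]_m) -> 'cV[R]_ny).
Context (S : seq 'I_np -> 'M[R]_(ny, m)).
Context (np_gt0 : (0 < np)%N) (P_unit : forall i : 'I_np, P (unit_vector i)).
Context (HS : is_IRR P H S).

(** The output at time $t$ determines the impulse response from time 1 to time
    $t$: apply an input supported at time 1. *)
Lemma realization_realizes_impulse n (sys : lpv_ssa R np m ny n) :
  is_realization P H sys -> realizes_impulse S sys.
Proof.
move=> Hsys q w j.
set d : 'cV[R]_np := unit_vector (Ordinal np_gt0).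
set s := q :: rcons w j; set t := (size w).+1.
set p := fun k => nth d (map unit_vector s) k.-1.
have Pp k : P (p k).
  rewrite /p; case: (ltnP k.-1 (size (map (@unit_vector R np) s))) => hk.
    by have /mapP[i _ ->] := mem_nth d hk.
  by rewrite nth_default //; apply: P_unit.
have size_s : size (map (@unit_vector R np) s) = t.+1 by rewrite size_map /= size_rcons.
have p_s : [seq p k | k <- iota 1 t.+1] = map unit_vector s by rewrite -size_s map_iota_nth.
have pE : p 1%N :: rcons [seq p k | k <- iota 2 (size w)] (p t.+1) =
    unit_vector q :: rcons (map unit_vector w) (unit_vector j).
  transitivity (map (@unit_vector R np) s); last by rewrite /s /= map_rcons.
  by rewrite -p_s /t -[in iota 1 _](addn1 (size w).+1) iotaD map_cat cats1 /= add1n.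
have p1 : p 1%N = unit_vector q by [].
have /eqP := congr1 behead pE; rewrite [behead _]/= [X in _ == X]/=; rewrite eqseq_rcons => /andP[/eqP p2 /eqP p3].
suff E : impulse S p t.+1 1 =
    lpv_mat (matC sys) (p t.+1) *m
      lpv_transition sys [seq p k | k <- iota 2 (size w)] *m lpv_mat (matB sys) (p 1%N).
  move: E; rewrite p1 p2 p3 !lpv_mat_unit => <-.
  by rewrite impulseE // subn1 p_s mlext_unit.
apply/row_matrixP => i; apply/rowP => l; rewrite !mxE.
pose v := fun tau : nat => if tau == 1%N then delta_mx l ord0 : 'cV[R]_m else 0.
have single k (F : nat -> 'M[R]_(k, m)) : \sum_(1 <= tau < t.+1) F tau *m v tau = col l (F 1%N).
  rewrite big_ltn // /v eqxx -colE big_nat big1 ?addr0 // => tau /andP[tau1 _].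
  by rewrite gtn_eqF // mulmx0.
have := HS v Pp (ltn0Sn t); rewrite single prefix_word_rcons.
rewrite (Hsys (prefix_word p v t) (p t.+1, v t.+1)) => [|qu].
  rewrite /= lpv_state_prefix single => /(congr1 (fun y : 'cV_ny => y i ord0)).
  by rewrite -[t in (t - 1)%N]addn1 addnK colE !mulmxA -colE !mxE => <-.
by rewrite -prefix_word_rcons => /mapP[k _ ->]; apply: Pp.
Qed.

Lemma realizes_impulse_realization n (sys : lpv_ssa R np m ny n) :
  realizes_impulse S sys -> is_realization P H sys.
Proof.
move=> Ssys w pv Pw.
set d : 'cV[R]_np * 'cV[R]_m := (unit_vector (Ordinal np_gt0), 0).
set pw := fun k => nth d (rcons w pv) k.-1.
have wE : prefix_word (fst \o pw) (snd \o pw) (size w).+1 = rcons w pv.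
  rewrite /prefix_word -[RHS](map_iota_nth d) size_rcons.
  by apply: eq_map => k /=; rewrite -surjective_pairing.
have Pp k : P ((fst \o pw) k).
  rewrite /pw /=; case: (ltnP k.-1 (size (rcons w pv))) => hk.
    by apply: Pw; apply: mem_nth.
  by rewrite nth_default //; apply: P_unit.
move: (wE); rewrite prefix_word_rcons => /eqP.
rewrite eqseq_rcons => /andP[/eqP wE' /eqP pvE].
rewrite -wE (HS _ Pp) // -(@output_prefix n sys S) // wE'.
by congr (lpv_mat _ _ *m _); rewrite -pvE.
Qed.

End ResponseMap.
End Realizations.

(** * Linear algebra of spans *)

Section Spans.
Context {R : realType}.

Lemma lin_span_incl (V : lmodType R) (X : set V) x : X x -> lin_span X x.
Proof.
by move=> Xx; exists 1%N, (fun=> 1), (fun=> x); rewrite big_ord1 scale1r.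
Qed.

Lemma lin_span_range (V : lmodType R) d (b : 'I_d -> V) y :
  lin_span (range b) y <-> exists c : 'I_d -> R, y = \sum_i c i *: b i.
Proof.
split=> [[n [c [x [xb ->]]]]|[c ->]]; last first.
  by exists d, c, b; split=> // i; exists i.
have {xb} /choice[k kE] : forall i, exists j, b j = x i.
  by move=> i; have [j _ <-] := xb i; exists j.
exists (fun j => \sum_(i | k i == j) c i).
rewrite (partition_big k predT) //=; apply: eq_bigr => j _.
by rewrite scaler_suml; apply: eq_bigr => i /eqP <-; rewrite kE.
Qed.

Lemma lin_span_eq (V : lmodType R) (G : set V) d (b : 'I_d -> V) :
  (forall i, G (b i)) -> (forall g, G g -> exists c : 'I_d -> R, g = \sum_i c i *: b i) ->
  lin_span (range b) = lin_span G.
Proof.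
move=> Gb spanb; apply/seteqP; split=> [y [k [c [z [zb ->]]]]|y [k [c [z [zG ->]]]]].
  by exists k, c, z; split=> // i; have [j _ <-] := zb i.
apply/lin_span_range; have /choice[a aE] := fun i => spanb _ (zG i).
exists (fun j => \sum_i c i * a i j).
under eq_bigr => i _ do rewrite aE scaler_sumr.
rewrite exchange_big; apply: eq_bigr => j _ /=.
by rewrite scaler_suml; apply: eq_bigr => i _; rewrite scalerA.
Qed.

(** An element outside the span of an independent family extends it, so a
    family of maximal size spans. *)
Lemma max_indep_family (V : lmodType R) (G : set V) (n : nat) :
  (forall d (b : 'I_d -> V), (forall i, G (b i)) -> lin_indep b -> (d <= n)%N) ->
  exists d (b : 'I_d -> V), [/\ (d <= n)%N, forall i, G (b i), lin_indep b &
    forall g, G g -> exists c : 'I_d -> R, g = \sum_i c i *: b i].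
Proof.
move=> bound.
pose famP d := `[< exists b : 'I_d -> V, (forall i, G (b i)) /\ lin_indep b >].
have ex0 : exists d, famP d.
  exists 0%N; apply/asboolP; exists (fun=> 0).
  by split=> [[]|c _ []].
have ub d : famP d -> (d <= n)%N by case/asboolP=> b [Gb ib]; apply: bound Gb ib.
case: (ex_maxnP ex0 ub) => d /asboolP[b [Gb ib]] dmax.
exists d, b; split=> // [|g Gg]; first exact: bound Gb ib.
have [//|gNspan] := pselect (exists c : 'I_d -> R, g = \sum_i c i *: b i).
suff /dmax : famP d.+1 by rewrite ltnn.
pose b' i := if unlift ord0 i is Some j then b j else g.
apply/asboolP; exists b'; split=> [i|c]; first by rewrite /b'; case: unliftP.
rewrite big_ord_recl /b' unlift_none.
under eq_bigr do rewrite liftK.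
have [c0|c0 sum0] := eqVneq (c ord0) 0.
  rewrite c0 scale0r add0r => /ib cl i.
  by case: (unliftP ord0 i) => [j ->|->].
exfalso; apply: gNspan; exists (fun i => - ((c ord0)^-1 * c (lift ord0 i))).
apply: (scalerI c0); rewrite scaler_sumr.
move/eqP: sum0; rewrite addr_eq0 => /eqP ->; rewrite -sumrN.
by apply: eq_bigr => i _; rewrite scalerA mulrN mulVKf // scaleNr.
Qed.

Lemma lin_indep_row_free n d (b : 'I_d -> 'rV[R]_n) :
  lin_indep b -> row_free (\matrix_i b i).
Proof.
move=> ib; apply: inj_row_free => v; rewrite mulmx_sum_row => v0.
have vi : forall i, v 0 i = 0.
  by apply: ib; rewrite -[RHS]v0; apply: eq_bigr => i _; rewrite rowK.
by apply/rowP => i; rewrite vi mxE.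
Qed.

Lemma mulmx_outer k l n (A : 'M[R]_(k, l)) (B : 'M[R]_(l, n)) :
  A *m B = \sum_i col i A *m row i B.
Proof.
apply/matrixP => i j; rewrite mxE summxE; apply: eq_bigr => t _.
by rewrite !mxE big_ord1 !mxE.
Qed.

(** A maximal independent family in $G$ is annihilated by the same vectors as
    $G$, hence has full rank; a left inverse of its matrix gives the columns. *)
Lemma annihilator0_resolution n (G : set 'rV[R]_n) :
  (forall x : 'cV[R]_n, (forall g, G g -> g *m x = 0) -> x = 0) ->
  exists k (g : 'I_k -> 'rV[R]_n) (c : 'I_k -> 'cV[R]_n),
    (forall i, G (g i)) /\ 1%:M = \sum_i c i *m g i.
Proof.
move=> annG; have [|d [b [_ Gb ib spanb]]] := @max_indep_family _ G n.
  move=> d b _ /lin_indep_row_free; rewrite /row_free => /eqP <-.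
  exact: rank_leq_col.
pose M := \matrix_i b i.
have Mfull : row_full M.
  rewrite -[M]trmxK /row_full mxrank_tr; apply: inj_row_free => v vM.
  apply: trmx_inj; rewrite trmx0; apply: annG => g /spanb[c ->].
  rewrite mulmx_suml big1 // => i _; rewrite -scalemxAl.
  have /(congr1 (row i)) : M *m v^T = 0 by apply: trmx_inj; rewrite trmx_mul trmxK trmx0.
  by rewrite row_mul rowK row0 => ->; rewrite scaler0.
exists d, b, (fun i => col i (pinvmx M)); split=> //.
rewrite -(mulVpmx Mfull) mulmx_outer.
by apply: eq_bigr => i _; rewrite rowK.
Qed.

End Spans.

(** * Hankel rank and minimal realizations *)

Section Hankel.
Context {R : realType} {np m ny : nat}.
Implicit Types (S : seq 'I_np -> 'M[R]_(ny, m)) (w v : seq 'I_np).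

Let dimO : nat := \sum_(j < np) ny.

Definition word_transition {n} (sys : lpv_ssa R np m ny n) w : 'M[R]_n :=
  lpv_transition sys (map unit_vector w).

Lemma word_transition_cat n (sys : lpv_ssa R np m ny n) v w :
  word_transition sys (v ++ w) = word_transition sys w *m word_transition sys v.
Proof. by rewrite /word_transition map_cat lpv_transition_cat. Qed.

(** The blocks are stacked as in the maps $M_{q,l}$, so that Hankel maps have
    the form $w \mapsto$ obs_mx $w$ times a state. *)
Definition obs_mx {n} (sys : lpv_ssa R np m ny n) w : 'M[R]_(dimO, n) :=
  \mxcol_(j < np) (matC sys j *m word_transition sys w).

Lemma MmapE S q l w : Mmap S q l w = col l (\mxcol_(j < np) S (q :: rcons w j)).
Proof.
by rewrite colE mxcol_mul; apply/mxcolP => j; rewrite !mxcolK colE.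
Qed.

(** The Hankel map of $(v, q, l)$ is the output sequence of the autonomous
    system started at the state reached from the $l$-th input under $q v$. *)
Lemma Mmap_obs S n (sys : lpv_ssa R np m ny n) v q l w :
  realizes_impulse S sys ->
  Mmap S q l (v ++ w) = obs_mx sys w *m (word_transition sys v *m col l (matB sys q)).
Proof.
move=> Ssys; rewrite MmapE !colE /obs_mx !mxcol_mul; apply/mxcolP => j.
by rewrite !mxcolK Ssys -/(word_transition _ _) word_transition_cat !mulmxA.
Qed.

Lemma obs_mx_sum n (sys : lpv_ssa R np m ny n) d (c : 'I_d -> R) (x : 'I_d -> 'cV[R]_n) :
  \sum_i c i *: ((fun w => obs_mx sys w *m x i) : seq 'I_np -> 'cV[R]_dimO) =
  (fun w => obs_mx sys w *m (\sum_i c i *: x i)).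
Proof.
rewrite fct_sumE; apply/funext => w; rewrite mulmx_sumr.
by apply: eq_bigr => i _; rewrite -scalemxAr.
Qed.

Definition reach_state {n} (sys : lpv_ssa R np m ny n) (x : 'cV[R]_n) : Prop :=
  exists v q l, x = word_transition sys v *m col l (matB sys q).

Lemma hankel_maps_state S n (sys : lpv_ssa R np m ny n) f :
  realizes_impulse S sys -> hankel_maps S f ->
  exists x, reach_state sys x /\ f = (fun w => obs_mx sys w *m x).
Proof.
move=> Ssys [v [q [l ->]]].
exists (word_transition sys v *m col l (matB sys q)); split; first by exists v, q, l.
by apply/funext => w; apply: Mmap_obs.
Qed.

Lemma lin_indep_states n (sys : lpv_ssa R np m ny n) d (x : 'I_d -> 'cV[R]_n) :
  lin_indep (fun i => (fun w => obs_mx sys w *m x i) : seq 'I_np -> 'cV[R]_dimO) ->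
  row_free (\matrix_i (x i)^T).
Proof.
move=> ix; apply: lin_indep_row_free => c c0; apply: ix.
rewrite obs_mx_sum //; apply/funext => w.
have -> : \sum_i c i *: x i = (\sum_i c i *: (x i)^T)^T.
  by rewrite linear_sum; apply: eq_bigr => i _; rewrite linearZ /= trmxK.
by rewrite c0 trmx0 mulmx0.
Qed.

(** The Hankel maps live in the image of the state space under the observation
    map, whence an independent family of them comes from independent states. *)
Lemma realization_hankel_basis S n (sys : lpv_ssa R np m ny n) :
  realizes_impulse S sys ->
  exists d (x : 'I_d -> 'cV[R]_n), let b i : seq 'I_np -> 'cV[R]_dimO := fun w => obs_mx sys w *m x i in
    [/\ (d <= n)%N, forall i, reach_state sys (x i), lin_indep b & hankel_rank S d].
Proof.
move=> Ssys; have [d e Ge ie|d [b [dn Gb ib spanb]]] := @max_indep_family _ _ (hankel_maps S) n.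
  have /choice[x xP] := fun i => hankel_maps_state Ssys (Ge i).
  have : row_free (\matrix_i (x i)^T).
    apply: (@lin_indep_states _ sys) => c c0; apply: ie; rewrite -[RHS]c0.
    by apply: eq_bigr => i _; have [_ ->] := xP i.
  by rewrite /row_free => /eqP <-; apply: rank_leq_col.
have /choice[x xP] := fun i => hankel_maps_state Ssys (Gb i).
have bE : b = fun i w => obs_mx sys w *m x i by apply/funext => i; have [_ ->] := xP i.
exists d, x; split=> //; first by move=> i; have [] := xP i.
  by rewrite -bE.
by exists b; split=> //; apply: lin_span_eq.
Qed.

(** The canonical realization: the state space is the span of the Hankel maps,
    the letter $j$ acts by $f \mapsto f(j\,\cdot)$, the input matrix of $q$ lists
    the maps $M_{q,l}$, and the output is read off $f$ at the empty word. *)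
Lemma hankel_rank_realization S d :
  hankel_rank S d -> exists sys : lpv_ssa R np m ny d, realizes_impulse S sys.
Proof.
move=> [b [_ spanb]].
have span_coord f : lin_span (hankel_maps S) f -> exists c : 'I_d -> R, f = \sum_i c i *: b i.
  by rewrite -spanb => /lin_span_range.
have shift f j : lin_span (hankel_maps S) f -> lin_span (hankel_maps S) (fun w => f (j :: w)).
  move=> [k [c [z [zG ->]]]]; exists k, c, (fun i w => z i (j :: w)); split.
    move=> i; have [v [q [l ->]]] := zG i; exists (rcons v j), q, l.
    by apply/funext => w; rewrite cat_rcons.
  by rewrite !fct_sumE.
have bS i : lin_span (hankel_maps S) (b i).
  by rewrite -spanb; apply: lin_span_incl; exists i.
have hankelS q l : lin_span (hankel_maps S) (Mmap S q l).
  by apply: lin_span_incl; exists [::], q, l.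
have /choice[a aE] := fun ji : 'I_np * 'I_d => span_coord _ (shift _ ji.1 (bS ji.2)).
have /choice[c cE] := fun ql : 'I_np * 'I_m => span_coord _ (hankelS ql.1 ql.2).
pose bm w : 'M[R]_(dimO, d) := \matrix_(r, i) b i w r ord0.
pose sys : lpv_ssa R np m ny d := {|
  matA := fun j => \matrix_(k, i) a (j, i) k;
  matB := fun q => \matrix_(k, l) c (q, l) k;
  matC := fun j => submxcol (bm [::]) j |}.
exists sys => q w j.
have step w' j' : bm (j' :: w') = bm w' *m matA sys j'.
  apply/matrixP => r i; rewrite !mxE.
  have /(congr1 (fun f : seq 'I_np -> 'cV[R]_dimO => f w' r ord0)) /= := aE (j', i); rewrite fct_sumE summxE => ->.
  by apply: eq_bigr => k _; rewrite !mxE mulrC.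
have -> : matC sys j *m lpv_transition sys (map unit_vector w) = submxcol (bm w) j.
  rewrite submxcol_mul; congr (submxcol _ j).
  suff trans u : bm (w ++ u) = bm u *m lpv_transition sys (map unit_vector w).
    by rewrite -[in RHS](cats0 w) trans.
  elim: w => [|i w IH] /=; first by rewrite mulmx1.
  by rewrite step IH lpv_transition_cons lpv_mat_unit mulmxA.
rewrite submxcol_mul -[LHS](mxcolK (fun j => S (q :: rcons w j))).
congr (submxcol _ j); apply/matrixP => r l.
have /(congr1 (fun f : seq 'I_np -> 'cV[R]_dimO => f w r ord0)) /= := cE (q, l).
rewrite MmapE mxE fct_sumE summxE => ->; rewrite !mxE.
by apply: eq_bigr => k _; rewrite !mxE mulrC.
Qed.

(** The reachable states span the state space: the identity is a combination
    of the finitely many blocks $A_v B_q$, with matrix coefficients. *)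
Definition reachable {n} (sys : lpv_ssa R np m ny n) : Prop :=
  exists k (v : 'I_k -> seq 'I_np) (q : 'I_k -> 'I_np) (E : 'I_k -> 'M[R]_(m, n)),
    1%:M = \sum_i word_transition sys (v i) *m matB sys (q i) *m E i.

(** Dually, the rows of the blocks $C_j A_w$ span all rows. *)
Definition observable {n} (sys : lpv_ssa R np m ny n) : Prop :=
  exists k (w : 'I_k -> seq 'I_np) (j : 'I_k -> 'I_np) (F : 'I_k -> 'M[R]_(n, ny)),
    1%:M = \sum_i F i *m matC sys (j i) *m word_transition sys (w i).

(** Minimality forces the Hankel rank to equal the dimension, hence a basis of
    reachable states which the observation map sends to independent maps. *)
Lemma minimal_reachable_observable S n (sys : lpv_ssa R np m ny n) :
  realizes_impulse S sys ->
  (forall n' (sys' : lpv_ssa R np m ny n'), realizes_impulse S sys' -> (n <= n')%N) ->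
  reachable sys /\ observable sys.
Proof.
move=> Ssys min; have [d [x /= [dn xreach ix rk]]] := realization_hankel_basis Ssys.
have [sys' /min nd] := hankel_rank_realization rk.
have dE : d = n by apply/eqP; rewrite eqn_leq dn.
case: _ / dE in sys Ssys min {dn nd} x xreach ix *.
set T := (\matrix_i (x i)^T)^T.
have Tunit : T \in unitmx.
  by rewrite unitmx_tr -row_free_unit; apply: (@lin_indep_states _ sys).
have colT i : col i T = x i by rewrite -tr_row rowK trmxK.
split.
  have /choice[v /choice[q /choice[l xE]]] := xreach.
  exists d, v, q, (fun i => delta_mx (l i) (ord0 : 'I_1) *m row i (invmx T)).
  rewrite -(mulmxV Tunit) mulmx_outer; apply: eq_bigr => i _.
  by rewrite colT xE colE !mulmxA.
have obs_inj (y : 'cV[R]_d) : (forall w, obs_mx sys w *m y = 0) -> y = 0.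
  move=> y0; rewrite -[y](mulKVmx Tunit); set c := invmx T *m y.
  have cE : T *m c = \sum_i c i ord0 *: x i.
    rewrite mulmx_outer; apply: eq_bigr => i _; rewrite colT.
    by apply/colP => r; rewrite !mxE big_ord1 !mxE mulrC.
  have c0 : forall i, c i ord0 = 0.
    apply: ix; rewrite obs_mx_sum // -cE mulKVmx //.
    exact/funext.
  by rewrite cE big1 // => i _; rewrite c0 scale0r.
have [y annih|k [g [c [gP sum1]]]] := @annihilator0_resolution _ d
    [set g | exists w j r, g = row r (matC sys j *m word_transition sys w)].
  apply: obs_inj => w; rewrite mxcol_mul; apply/mxcolP => j; rewrite mxcolK.
  apply/row_matrixP => r; rewrite row_mul annih; last by exists w, j, r.
  by apply/rowP => t; rewrite !mxE.
have /choice[w /choice[j /choice[r gE]]] := gP.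
exists k, w, j, (fun i => c i *m delta_mx (ord0 : 'I_1) (r i)).
rewrite sum1; apply: eq_bigr => i _.
by rewrite gE rowE !mulmxA.
Qed.

End Hankel.

(** * Stability *)

Section Stability.
Context {R : realType} {np m ny : nat} (P : set 'cV[R]_np).
Context (P_simplex : P `<=` std_simplex R np).
Implicit Types (S : seq 'I_np -> 'M[R]_(ny, m)) (ps : seq 'cV[R]_np).

Lemma norm1_lpv_mat k l (M : 'I_np -> 'M[R]_(k, l)) p :
  P p -> norm1 (lpv_mat M p) <= \sum_i norm1 (M i).
Proof.
move=> /P_simplex[p01 _]; apply: le_trans (norm1_sum _ _ _) _.
apply: ler_sum => i _; rewrite norm1Z ler_piMl ?norm1_ge0 //.
by have /andP[p0 p1] := p01 i; rewrite ger0_norm.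
Qed.

(** Inserting the resolutions of the identity on both sides of a transition
    matrix turns it into a fixed combination of values of the impulse response
    on longer words. *)
Lemma transition_bound S n (sys : lpv_ssa R np m ny n) :
  (forall i, P (unit_vector i)) ->
  realizes_impulse S sys -> reachable sys -> observable sys ->
  exists2 K : R, 0 <= K & forall (b : R) N,
    (forall ps, (N.+2 <= size ps)%N -> (forall q, q \in ps -> P q) ->
       norm1 (mlext S ps) <= b) ->
    forall ps, (N <= size ps)%N -> (forall q, q \in ps -> P q) ->
      norm1 (lpv_transition sys ps) <= K * b.
Proof.
move=> P_unit Ssys [k1 [v [q [E sum1E]]]] [k2 [w [j [F sum1F]]]].
exists (\sum_i1 \sum_i2 norm1 (F i2) * norm1 (E i1)).
  by apply: sumr_ge0 => i1 _; apply: sumr_ge0 => i2 _; rewrite mulr_ge0 ?norm1_ge0.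
move=> b N Hb ps Nps Pps.
rewrite -[lpv_transition sys ps]mulmx1 sum1E mulmx_sumr mulr_suml.
apply: le_trans (norm1_sum _ _ _) _; apply: ler_sum => i1 _.
rewrite -[_ *m (_ *m _)]mul1mx sum1F mulmx_suml mulr_suml.
apply: le_trans (norm1_sum _ _ _) _; apply: ler_sum => i2 _.
pose uv := map (@unit_vector R np) (v i1); pose uw := map (@unit_vector R np) (w i2).
have -> : F i2 *m matC sys (j i2) *m word_transition sys (w i2) *m
    (lpv_transition sys ps *m (word_transition sys (v i1) *m matB sys (q i1) *m E i1)) =
  F i2 *m mlext S (unit_vector (q i1) :: rcons (uv ++ ps ++ uw) (unit_vector (j i2))) *m E i1.
  by rewrite (mlext_realizes _ _ _ Ssys) !lpv_mat_unit !lpv_transition_cat !mulmxA.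
apply: le_trans (norm1M _ _) _; rewrite mulrAC ler_wpM2r ?norm1_ge0 //.
apply: le_trans (norm1M _ _) _; rewrite ler_wpM2l ?norm1_ge0 //.
apply: Hb => [|p]; first by rewrite /= size_rcons !size_cat; lia.
rewrite inE mem_rcons inE !mem_cat => /or4P[/eqP ->|/eqP ->|/mapP[i _ ->]|] //.
by case/orP=> [/Pps|/mapP[i _ ->]].
Qed.

(** The factor $n$ is the norm of the identity matrix. *)
Lemma norm1_transition_size n (sys : lpv_ssa R np m ny n) :
  exists2 a : R, 1 <= a & forall ps, (forall q, q \in ps -> P q) ->
    norm1 (lpv_transition sys ps) <= n%:R * a ^+ size ps.
Proof.
set s := \sum_i norm1 (matA sys i).
have s0 : 0 <= s by apply: sumr_ge0 => i _; apply: norm1_ge0.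
exists (1 + s) => [|ps]; first by rewrite lerDl.
elim/last_ind: ps => [|ps p IH] Pps; first by rewrite norm1_1 mulr1.
rewrite lpv_transition_rcons size_rcons exprSr mulrA mulrC.
apply: le_trans (norm1M _ _) _; apply: ler_pM; rewrite ?norm1_ge0 //.
  apply: le_trans (norm1_lpv_mat _ _) _; first by apply: Pps; rewrite mem_rcons mem_head.
  by rewrite lerDr.
by apply: IH => q qps; apply: Pps; rewrite mem_rcons inE qps orbT.
Qed.

Lemma bernoulli_le (x : R) N : 0 <= x <= 1 -> 1 - N%:R * x <= (1 - x) ^+ N.
Proof.
move=> /andP[x0 x1]; elim: N => [|N IH]; first by rewrite mul0r subr0.
apply: (@le_trans _ _ ((1 - N%:R * x) * (1 - x))); last first.
  by rewrite exprSr ler_wpM2r // subr_ge0.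
have : 0 <= N%:R * x * x by rewrite !mulr_ge0.
by rewrite -natr1; nra.
Qed.

(** If all transitions of one length halve the norm, cutting a word into blocks
    of that length gives exponential decay. The rate $1 - 1/(2N)$ avoids the
    $N$-th root of $1/2$: its $N$-th power is at least $1/2$ by Bernoulli. *)
Lemma GUES_of_contraction n (sys : lpv_ssa R np m ny n) N : (0 < N)%N ->
  (forall ps, size ps = N -> (forall q, q \in ps -> P q) ->
     norm1 (lpv_transition sys ps) <= 2^-1) ->
  GUES P sys.
Proof.
move=> N0 contr; have [a a1 aP] := norm1_transition_size sys.
have N0' : 0 < N%:R :> R by rewrite ltr0n.
have N1' : 1 <= N%:R :> R by rewrite ler1n.
set x : R := (2 * N%:R)^-1.
have xN : N%:R * x = 2^-1 by rewrite /x invfM mulrCA divff ?mulr1 // gt_eqF.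
have x0 : 0 < x by rewrite invr_gt0 mulr_gt0.
have x1 : x <= 2^-1 by rewrite -xN ler_peMl // ltW.
set beta := 1 - x.
have b01 : 0 < beta < 1 by rewrite /beta; lra.
have /andP[b0 b1] := b01.
have half_bN r : (r <= N)%N -> 2^-1 <= beta ^+ r.
  move=> rN; apply: (@le_trans _ _ (beta ^+ N)).
    by apply: le_trans (bernoulli_le _ _); [rewrite xN; lra|lra].
  by apply: ler_wiXn2l => //; exact: ltW.
set K : R := n%:R * a ^+ N.
have K0 : 0 <= K by rewrite mulr_ge0 // exprn_ge0 // (le_trans _ a1).
(* A word shorter than $N$ has norm at most $K$, and the factor 2 pays for its
   power of beta, which is at least $1/2$. *)
have decay ps : (forall q, q \in ps -> P q) ->
    norm1 (lpv_transition sys ps) <= 2 * K * beta ^+ size ps.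
  have [k] := ubnP (size ps); elim: k ps => // k IH ps szk Pps.
  have [Nps|psN] := leqP N (size ps).
    have drop_lt : (size (drop N ps) < k)%N by rewrite size_drop; lia.
    rewrite -{1}(cat_take_drop N ps) lpv_transition_cat.
    apply: le_trans (norm1M _ _) _.
    apply: (@le_trans _ _ (2 * K * beta ^+ size (drop N ps) * 2^-1)).
      apply: ler_pM; rewrite ?norm1_ge0 //.
        by apply: IH => // q /mem_drop; apply: Pps.
      apply: contr => [|q /mem_take]; last exact: Pps.
      by rewrite size_take; case: ltngtP Nps.
    rewrite -[X in _ <= _ * beta ^+ X](subnK Nps) size_drop exprD mulrA.
    apply: ler_wpM2l (half_bN _ (leqnn N)).
    by apply: mulr_ge0; [apply: mulr_ge0|apply/exprn_ge0/ltW].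
  apply: le_trans (aP _ Pps) _; apply: (@le_trans _ _ K).
    by rewrite ler_wpM2l // ler_weXn2l // ltnW.
  have := half_bN _ (ltnW psN); nra.
exists beta => //; exists (1 + 2 * K) => [|ps ps0 Pps]; first by rewrite lerDl mulr_ge0.
apply: le_lt_trans (spectral_norm_le_norm1 _) _; apply: le_lt_trans (decay _ Pps) _.
by rewrite ltr_pM2r ?exprn_gt0 // ltrDr.
Qed.

(** At the lag $N$ the response $C(p') \Phi B(p)$ contains $N - 1$ transition
    factors, which is the exponent in IRR-UED. *)
Lemma GUES_rate_IRR_UED S n (sys : lpv_ssa R np m ny n) beta : 0 < beta ->
  realizes_impulse S sys -> GUES_rate P sys beta -> IRR_UED P S beta.
Proof.
move=> b0 Ssys [C C1 HC].
set cB := \sum_i norm1 (matB sys i); set cC := \sum_i norm1 (matC sys i).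
have cB0 : 0 <= cB by apply: sumr_ge0 => i _; apply: norm1_ge0.
have cC0 : 0 <= cC by apply: sumr_ge0 => i _; apply: norm1_ge0.
set c := n%:R + (n * n)%:R * C.
have C0 : 0 <= C by rewrite (le_trans _ C1).
have c0 : 0 <= c by rewrite addr_ge0 // mulr_ge0.
have trans ps : (forall q, q \in ps -> P q) ->
    norm1 (lpv_transition sys ps) <= c * beta ^+ size ps.
  case: ps => [|p ps] Pps; first by rewrite norm1_1 mulr1 lerDl mulr_ge0.
  apply: le_trans (norm1_le_spectral_norm _) _.
  rewrite mulrDl -mulrA; apply: ler_wpDl; first by rewrite mulr_ge0 // exprn_ge0 // ltW.
  by apply: ler_wpM2l => //; apply/ltW/HC.
set D := cC * c * cB; have D0 : 0 <= D by rewrite !mulr_ge0.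
exists (1 + D) => [|N N1]; first by rewrite ltr_pwDl.
apply: (@le_lt_trans _ _ (D * beta ^+ (N - 1))%:E); last first.
  by rewrite lte_fin ltr_pM2r ?exprn_gt0 // ltrDr.
apply/impulse_sup_le => -[//|p /lastP[|ps p'] szp Pps]; first by move: szp => /=; lia.
apply: le_trans (spectral_norm_le_norm1 _) _; rewrite (mlext_realizes _ _ _ Ssys).
have Pp : P p by apply: Pps; rewrite mem_head.
have Pp' : P p' by apply: Pps; rewrite inE mem_rcons mem_head orbT.
have Pps' q : q \in ps -> P q by move=> h; apply: Pps; rewrite inE mem_rcons inE h !orbT.
have -> : (N - 1)%N = size ps by move: szp; rewrite /= size_rcons; lia.
rewrite /D mulrAC; apply: le_trans (norm1M _ _) _.
apply: ler_pM; rewrite ?norm1_ge0 ?norm1_lpv_mat //.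
apply: le_trans (norm1M _ _) _; rewrite -mulrA.
by apply: ler_pM; rewrite ?norm1_ge0 ?norm1_lpv_mat //; apply: trans.
Qed.

(** The inserted words lengthen the response word, which only improves the bound
    because $\beta < 1$; the rate is therefore preserved. *)
Lemma IRR_UED_GUES_rate S n (sys : lpv_ssa R np m ny n) beta : 0 < beta < 1 ->
  (forall i, P (unit_vector i)) ->
  realizes_impulse S sys -> reachable sys -> observable sys ->
  IRR_UED P S beta -> GUES_rate P sys beta.
Proof.
move=> /andP[b0 b1] P_unit Ssys reach obs [C C0 HC].
have [K K0 HK] := transition_bound P_unit Ssys reach obs.
set c : R := (ny * m)%:R * C.
have c0 : 0 <= c by rewrite mulr_ge0 // ltW.
exists (1 + K * c) => [|ps ps0 Pps]; first by rewrite lerDl mulr_ge0.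
apply: (@le_lt_trans _ _ (K * c * beta ^+ size ps)); last first.
  by rewrite ltr_pM2r ?exprn_gt0 // ltrDr.
apply: le_trans (spectral_norm_le_norm1 _) _; rewrite -mulrA.
apply: (HK _ (size ps)) => // rs szrs Prs.
apply: le_trans (norm1_le_spectral_norm _) _; rewrite -mulrA ler_wpM2l //.
have sz1 : (1 <= (size rs).-1)%N by lia.
have /ltW/impulse_sup_le HN := HC _ sz1.
apply: (@le_trans _ _ (C * beta ^+ ((size rs).-1 - 1))).
  by apply: HN => //; lia.
apply: ler_wpM2l; first exact: ltW.
by apply: ler_wiXn2l; [exact: ltW|exact: ltW|lia].
Qed.

(** The supremum over words of length $N + 1$ bounds the response on each of
    them. *)
Lemma IRR_UD_eventually S : IRR_UD P S -> forall eps : R, 0 < eps ->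
  exists N, forall ps, (N < size ps)%N -> (forall q, q \in ps -> P q) ->
    norm1 (mlext S ps) <= eps.
Proof.
move=> UD eps e0; set c : R := 1 + (ny * m)%:R.
have c0 : 0 < c by rewrite ltr_pwDl.
have /UD[N _ HN] : nbhs (0 : \bar R)%E [set x | (x < (eps / c)%:E)%E].
  by apply: open_ereal_lt'; rewrite lte_fin divr_gt0.
exists N => ps szps Pps; apply: le_trans (norm1_le_spectral_norm _) _.
have szN : (N <= (size ps).-1)%N by lia.
have /ltW/impulse_sup_le HNs := HN _ szN.
have {}HNs : spectral_norm (mlext S ps) <= eps / c by apply: HNs => //; lia.
apply: (@le_trans _ _ (c * (eps / c))); last by rewrite mulrC divfK // gt_eqF.
by apply: ler_pM; rewrite ?spectral_norm_ge0 // lerDr.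
Qed.

Lemma IRR_UD_GUES S n (sys : lpv_ssa R np m ny n) :
  (forall i, P (unit_vector i)) ->
  realizes_impulse S sys -> reachable sys -> observable sys ->
  IRR_UD P S -> GUES P sys.
Proof.
move=> P_unit Ssys reach obs UD.
have [K K0 HK] := transition_bound P_unit Ssys reach obs.
have K1 : 0 < 1 + K by rewrite ltr_pwDl.
have [|N HN] := IRR_UD_eventually UD (eps := (2 * (1 + K))^-1).
  by rewrite invr_gt0 mulr_gt0.
apply: (@GUES_of_contraction _ _ N.+1) => // ps szps Pps.
apply: (@le_trans _ _ (K * (2 * (1 + K))^-1)).
  by apply: (HK _ N) => // [rs szrs|]; [apply: HN; lia|rewrite szps].
rewrite invfM mulrCA ler_piMr ?invr_ge0 // ler_pdivrMr // mul1r.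
by rewrite lerDr.
Qed.

Lemma IRR_UED_IRR_UD S beta : (exists p, P p) -> 0 < beta < 1 ->
  IRR_UED P S beta -> IRR_UD P S.
Proof.
move=> [p Pp] /andP[b0 b1] [C C0 HC].
apply: (@squeeze_cvge _ _ _ _ (cst 0%E) _ (fun N => (C / beta * beta ^+ N)%:E)).
- near=> N; apply/andP; split.
    apply: le_trans (ereal_sup_ubound _); last first.
      by exists (fun=> p), 1%N; split.
    by rewrite lee_fin spectral_norm_ge0.
  have N1 : (1 <= N)%N by near: N; exact: nbhs_infty_ge.
  apply: le_trans (ltW (HC _ N1)) _; rewrite lee_fin.
  have -> : beta ^+ N = beta ^+ (N - 1) * beta by rewrite -exprSr subn1 prednK.
  by rewrite mulrACA mulVf ?gt_eqF // mulr1.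
- exact: cvg_cst.
- apply: cvg_EFin; first exact: nearW.
  rewrite -[0](mulr0 (C / beta)); apply: cvgMr.
  by apply: cvg_expr; rewrite ger0_norm // ltW.
Unshelve. all: by end_near. Qed.

End Stability.

(** * Decay of the response and stability of realizations *)

Theorem mainTheorem3 (R : realType) (np m ny : nat) (P : set 'cV[R]_np)
  (H : seq ('cV[R]_np * 'cV[R]_m) -> 'cV[R]_ny)
  (S : seq 'I_np -> 'M[R]_(ny, m))
  (np_gt0 : (0 < np)%N)
  (P_simplex : P `<=` std_simplex R np)
  (P_unit : forall i : 'I_np, P (unit_vector i))
  (HS : is_IRR P H S) :
  [/\ (* (A) *)
      finite_hankel_rank S ->
        (IRR_UD P S <-> exists2 beta : R, 0 < beta < 1 & IRR_UED P S beta),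
      (* (B) *)
      (exists (n : nat) (sys : lpv_ssa R np m ny n),
         is_realization P H sys /\ GUES P sys)
        <-> finite_hankel_rank S /\ IRR_UD P S
    & (* (C) *)
      (exists (n : nat) (sys : lpv_ssa R np m ny n), is_realization P H sys) ->
      forall beta : R, 0 < beta < 1 ->
        (IRR_UED P S beta <->
         forall (n : nat) (sys : lpv_ssa R np m ny n),
           is_minimal_realization P H sys -> GUES_rate P sys beta)].
Proof.
have real_iff n (sys : lpv_ssa R np m ny n) : is_realization P H sys <-> realizes_impulse S sys.
  split; first exact: realization_realizes_impulse np_gt0 P_unit HS _ _.
  exact: realizes_impulse_realization np_gt0 P_unit HS _ _.
have P_nonempty : exists p, P p by exists (unit_vector (Ordinal np_gt0)).
have minimal_exists n (sys : lpv_ssa R np m ny n) : realizes_impulse S sys ->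
    exists n' (sys' : lpv_ssa R np m ny n'), [/\ realizes_impulse S sys',
      forall k (s : lpv_ssa R np m ny k), realizes_impulse S s -> (n' <= k)%N,
      reachable sys' & observable sys'].
  move=> Ssys.
  pose has_real k := `[< exists s : lpv_ssa R np m ny k, realizes_impulse S s >].
  have ex_real : exists k, has_real k by exists n; apply/asboolP; exists sys.
  case: (ex_minnP ex_real) => n' /asboolP[sys' Ssys'] min.
  have min' k (s : lpv_ssa R np m ny k) : realizes_impulse S s -> (n' <= k)%N.
    by move=> Ss; apply: min; apply/asboolP; exists s.
  have [reach obs] := minimal_reachable_observable Ssys' min'.
  by exists n', sys'.
have stable_realization : finite_hankel_rank S -> IRR_UD P S ->
    exists n (sys : lpv_ssa R np m ny n), realizes_impulse S sys /\ GUES P sys.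
  move=> [d /hankel_rank_realization[sys0 Ssys0]] UD.
  have [n [sys [Ssys _ reach obs]]] := minimal_exists _ _ Ssys0.
  exists n, sys; split=> //; exact: (IRR_UD_GUES P_simplex P_unit Ssys reach obs UD).
split.
- move=> rank_fin; split=> [UD|[beta b01 UED]]; last exact: IRR_UED_IRR_UD P_nonempty b01 UED.
  have [n [sys [Ssys [beta b01 stab]]]] := stable_realization rank_fin UD.
  exists beta => //; have /andP[b0 _] := b01.
  exact: (GUES_rate_IRR_UED P_simplex b0 Ssys stab).
- split=> [[n [sys [/real_iff Ssys [beta b01 stab]]]]|[rank_fin UD]].
    have /andP[b0 _] := b01; split.
      by have [d [x [_ _ _ rk]]] := realization_hankel_basis Ssys; exists d.
    apply: IRR_UED_IRR_UD P_nonempty b01 _.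
    exact: (GUES_rate_IRR_UED P_simplex b0 Ssys stab).
  have [n [sys [Ssys stab]]] := stable_realization rank_fin UD.
  by exists n, sys; split=> //; apply/real_iff.
- move=> [n0 [sys0 /real_iff Ssys0]] beta b01; have /andP[b0 _] := b01.
  split=> [UED n sys [/real_iff Ssys min]|all_stable].
    have [reach obs] : reachable sys /\ observable sys.
      by apply: minimal_reachable_observable Ssys _ => k s /real_iff; apply: min.
    exact: (IRR_UED_GUES_rate b01 P_unit Ssys reach obs UED).
  have [n [sys [Ssys min _ _]]] := minimal_exists _ _ Ssys0.
  apply: (GUES_rate_IRR_UED P_simplex b0 Ssys); apply: all_stable.
  by split=> [|k s /real_iff]; [apply/real_iff|apply: min].
Qed.
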